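(* Let $W$ be a mean zero random variable with finite, nonzero variance $\sigma^2$, and suppose $(W,W^* )$ is given on a joint probability space so that $W^*$ has the $W$-zero biased distribution. Then for all $h:\mathbb{R}\to\mathbb{R}$ with four bounded derivatives, $$|Eh(W/\sigma)-\Phi h|\le\frac{1}{3\sigma}\|h^{(3)}\|\sqrt{E\{E(W^*-W\mid W)^2\}}+\frac{1}{8\sigma^2}\|h^{(4)}\|\,E(W^*-W)^2$$ (the right-hand side being read as $+\infty$ if $E(W^*-W)^2=\infty$).
   Context: For a mean zero random variable $W$ with finite, nonzero variance $\sigma^2$, a random variable $W^*$ has the $W$-zero biased distribution if $E[Wf(W)]=\sigma^2E[f'(W^* )]$ for all differentiable $f:\mathbb{R}\to\mathbb{R}$ for which both expectations exist (are absolutely convergent). This distribution exists and is unique. $\Phi h=Eh(Z)$ with $Z\sim\mathcal{N}(0,1)$; $\|\cdot\|$ is the supremum norm; $h$ has four bounded derivatives if $h$ is four times differentiable and $h^{(1)},\ldots,h^{(4)}$ are bounded. $E\{E(W^*-W\mid W)^2\}$ denotes the expectation of the square of the conditional expectation $E(W^*-W\mid W)$. *)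

(* Defs.v *)
From HB Require Import structures.
From mathcomp Require Import all_boot all_order all_algebra.
From mathcomp Require Import all_classical all_reals all_analysis.
From mathcomp Require Import measurable_realfun.
Set Implicit Arguments.
Unset Strict Implicit.
Unset Printing Implicit Defensive.
Import Order.TTheory GRing.Theory Num.Theory.
Import numFieldNormedType.Exports.

Local Open Scope ring_scope.
Local Open Scope classical_set_scope.
Local Open Scope ereal_scope.

Definition zero_biased d (T : measurableType d) (R : realType)
    (P : probability T R) (W Ws : T -> R) : Prop :=
  forall f : R -> R,
    (forall x, derivable f x 1) ->
    P.-integrable setT (fun w => (W w * f (W w))%:E) ->
    P.-integrable setT (fun w => (f^`()%classic (Ws w))%:E) ->
    'E_P[fun w => (W w * f (W w))%R] =
      'V_P[W] * 'E_P[fun w => f^`()%classic (Ws w)].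

(* [Y] is a version of the conditional expectation E(X | W), that is, given the
   sigma-algebra of all [W @^-1` B] with [B] Borel. *)
Definition is_cond_exp d (T : measurableType d) (R : realType)
    (P : probability T R) (X W Y : T -> R) : Prop :=
  let sigmaW := preimage_set_system setT W measurable in
  [/\ P.-integrable setT (EFin \o X),
      P.-integrable setT (EFin \o Y),
      forall B : set R, measurable B -> sigmaW (Y @^-1` B) &
      forall A, sigmaW A ->
        \int[P]_(w in A) (Y w)%:E = \int[P]_(w in A) (X w)%:E].

Definition bounded_derivatives (R : realType) (n : nat) (h : R -> R) : Prop :=
  (forall k x, (k < n)%N -> derivable (h^`(k)%classic) x 1) /\
  (forall k, (1 <= k <= n)%N -> bounded_fun (h^`(k)%classic)).

(* [sup] is total, so this is the supremum norm only when [f] is bounded. *)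
Definition sup_norm (R : realType) (f : R -> R) : R :=
  sup (range (fun x => `|f x|%R)).

(* The factorization E(X | W) = g o W, with g the density of the image under W
   of the charge A |-> E[X; A] with respect to the law of W. *)
Lemma is_cond_exp_exists d (T : measurableType d) (R : realType)
    (P : probability T R) (X : T -> R) (W : {RV P >-> R}) :
  P.-integrable setT (EFin \o X) -> exists Y, is_cond_exp P X W Y.
Proof.
move=> iX.
have mW : measurable_fun setT W by exact: measurable_funPT.
have mWV B : measurable B -> measurable (W @^-1` B).
  by move=> mB; rewrite -[X in measurable X]setTI; exact: mW.
pose mu : {charge set T -> \bar R} := induced_charge iX.
pose nu_ : {charge set R -> \bar R} := HB.pack (pushforward mu W).
pose nu := nu_ mW mW mW.
pose Q := distribution P W.
have nuQ : nu `<< Q.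
  apply/null_content_dominatesP => A mA QA; apply: null_set_integral => //.
  - exact: mWV.
  - exact: measurable_funS (measurable_int _ iX).
pose g : R -> \bar R := Radon_Nikodym nu Q.
have gfin x : g x \is a fin_num by exact: Radon_Nikodym_fin_num.
have ig : Q.-integrable setT g by exact: Radon_Nikodym_integrable.
have mg : measurable_fun [set: R] g by exact: measurable_int ig.
have gWE : EFin \o (fine \o g \o W) = g \o W.
  by apply/funext => w /=; rewrite fineK.
have igW : P.-integrable setT (g \o W).
  apply/integrableP; split; first exact: measurableT_comp.
  case/integrableP: ig => _.
  by rewrite ge0_integral_distribution//; exact: measurableT_comp.
exists (fine \o g \o W); split => //.
- by rewrite gWE.
- move=> B mB; exists ((fine \o g) @^-1` B); last by rewrite setTI.
  rewrite -[X in measurable X]setTI.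
  exact: (measurableT_comp (fine_measurable measurableT) mg).
- move=> _ [B mB <-]; rewrite setTI.
  have -> : \int[P]_(w in W @^-1` B) ((fine \o g \o W) w)%:E =
            \int[P]_(w in W @^-1` B) (g \o W) w.
    by apply: eq_integral => w _; rewrite /= fineK.
  rewrite -[RHS]/(nu B) (Radon_Nikodym_integral nuQ mB).
  rewrite [RHS]integral_pushforward//.
  by apply: (integrableS _ _ _ igW) => //; exact: mWV.
Qed.

(* Main.v *)
Require Import Defs.
From mathcomp Require Import all_boot all_order all_algebra.
From mathcomp Require Import all_classical all_reals all_analysis.
From mathcomp Require Import ring lra measurable_realfun.

(** The proof is Stein's method with zero biasing. Write N for the standard
    normal law and Nh for the mean of h under N.

    First, h(x) - Nh = x a0(x) - a1(x) with a0 differentiable and a1 = a0'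
    (stein_solution). Explicitly, ak(x) is the integral over angles t in
    [0, pi/2] and normal z of cos t (sin t)^k times the (k+1)-st derivative of h
    at x sin t + z cos t. The equation is the fundamental theorem of calculus
    along the rotation from z to x, combined with Fubini and Gaussian integration
    by parts (stein_equation, stein_integration_by_parts). Since cos sin^k has
    mass 1/(k+1), a2 is bounded by 1/3 of the norm of the third derivative of h,
    and the second-order Taylor error of a1 is at most 1/2 times 1/4 of the norm
    of the fourth derivative times the squared increment (arc_average_bounded,
    arc_average_taylor). These are the constants 1/3 and 1/8.

    Second, zero biasing applied to w |-> a0(w / sigma) turns
    E[(W / sigma) a0(W / sigma)] into E[a1(Ws / sigma)], so that
      E h(W / sigma) - Nh = E[a1(Ws / sigma) - a1(W / sigma)].
    The Taylor expansion of a1 at W / sigma has linear part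
    a2(W / sigma) (Ws - W) / sigma, where Ws - W can be replaced by its
    conditional expectation Y given W (is_cond_exp_pull_out), and E|Y| is at most
    the square root of E Y^2; the remainder gives the second term of the bound
    (zero_bias_bound). *)

Set Implicit Arguments.
Unset Strict Implicit.
Unset Printing Implicit Defensive.
Import Order.TTheory GRing.Theory Num.Theory.
Import numFieldNormedType.Exports.
Local Open Scope ring_scope.
Local Open Scope classical_set_scope.

(** * Real functions with Lipschitz derivatives *)

Section calculus.
Context (R : realType).
Implicit Types f : R -> R.

Lemma derivableT_continuous f : (forall x, derivable f x 1) -> continuous f.
Proof. by move=> df x; apply/differentiable_continuous/derivable1_diffP. Qed.

Lemma bounded_derive1_lipschitz f (M : R) :
  (forall x, derivable f x 1) -> (forall x, `|f^`() x| <= M) ->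
  forall x y, `|f x - f y| <= M * `|x - y|.
Proof.
move=> df f'M x y; wlog yx : x y / y <= x.
  by move=> H; case/orP: (le_total y x) => [/H//|/H]; rewrite distrC (distrC y).
have [||c _ ->] := @MVT_segment R f f^`() y x yx.
- by move=> t _; rewrite derive1E; exact/derivableP/df.
- exact/continuous_subspaceT/derivableT_continuous.
- by rewrite normrM ler_wpM2r.
Qed.

Lemma lipschitz_continuous f (M : R) :
  (forall x y, `|f x - f y| <= M * `|x - y|) -> continuous f.
Proof.
move=> fM x; apply/cvgrPdist_le => e e0; near=> t.
rewrite (le_trans (fM _ _))//.
have M0 : 0 < `|M| + 1 by rewrite ltr_wpDl.
rewrite (@le_trans _ _ ((`|M| + 1) * `|x - t|))//.
  by rewrite ler_wpM2r// (le_trans (ler_norm M))// lerDl.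
rewrite mulrC -ler_pdivlMr//; near: t.
by apply: cvgr_dist_le => //; exact: divr_gt0.
Unshelve. all: by end_near. Qed.

Lemma continuous_scale (u : R -> R) (c : R) :
  continuous u -> continuous (fun y : R => u (y / c)).
Proof.
move=> cu y; have cm : (fun z : R => z / c) @ y --> y / c.
  by apply: cvgM; [exact: cvg_id|exact: cvg_cst].
exact: (cvg_comp _ _ cm (cu (y / c))).
Qed.

(** Moving along the segment from a to b turns the statement into the
    monotonicity on [0, 1] of an auxiliary function; keeping the full quadratic
    term gives the factor 1/2 which the mean value theorem alone would lose. *)
Lemma taylor1_lipschitz f (M : R) :
  (forall x, derivable f x 1) ->
  (forall x y, `|f^`()%classic x - f^`()%classic y| <= M * `|x - y|) ->
  forall a b, `|f b - f a - (b - a) * f^`()%classic a| <= M / 2 * (b - a) ^+ 2.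
Proof.
move=> df f'M a b; set h := b - a.
(* e = 1 and e = -1 give the two sides of the absolute value *)
suff key (e : R) : `|e| = 1 ->
    e * (f b - f a - h * f^`()%classic a) <= M / 2 * h ^+ 2.
  have k1 := key 1 (normr1 _); have kN := key (-1) (normrN1 _).
  by rewrite ler_norml; apply/andP; split; lra.
move=> e1.
pose u (s : R) := f (a + s * h).
have du (s : R) : is_derive s 1 u (h * f^`()%classic (a + s * h)).
  have di : is_derive s 1 (fun s : R => a + s * h) h.
    have -> : (fun s : R => a + s * h) = cst a + id * cst h by [].
    have := is_deriveD (is_derive_cst a s 1)
      (is_deriveM (is_derive_id s 1) (is_derive_cst h s 1)).
    move=> /trigger_derive; apply.
    by rewrite /GRing.scale /=; ring.
  have dfs : is_derive (a + s * h) 1 f (f^`()%classic (a + s * h)).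
    by rewrite derive1E; exact/derivableP/df.
  have := @is_derive1_comp R f (fun s : R => a + s * h) s _ _ dfs di.
  by rewrite mulrC.
pose p (s : R) := M / 2 * h ^+ 2 * s ^+ 2 -
  e * (u s - s * (h * f^`()%classic a)).
have dp (s : R) : is_derive s 1 p
    (M * h ^+ 2 * s - e * (h * (f^`()%classic (a + s * h) - f^`()%classic a))).
  apply: (@trigger_derive _ (cst (M / 2 * h ^+ 2) * id ^+ 2 -
    cst e * (u - id * cst (h * f^`()%classic a)))).
  by rewrite /GRing.scale/= /cst/=; field.
have pd (s : R) : derivable p s 1 by case: (dp s).
have : p 0 <= p 1.
  apply: (@ger0_derive1_le_cc _ p 0 1).
  - by move=> s _; exact: pd.
  - move=> s; rewrite in_itv/= => /andP[s0 s1].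
    rewrite derive1E (@derive_val _ _ _ _ _ _ _ (dp s)) subr_ge0.
    rewrite (le_trans (ler_norm _))// normrM e1 mul1r normrM.
    rewrite (le_trans (ler_wpM2l (normr_ge0 h) (f'M _ _)))//.
    rewrite addrC addKr normrM (gtr0_norm s0) -[h ^+ 2]real_normK ?num_real//.
    by rewrite [leLHS](_ : _ = M * `|h| ^+ 2 * s)//; ring.
  - apply/continuous_subspaceT => s.
    exact/differentiable_continuous/derivable1_diffP/pd.
  - by rewrite in_itv/= lexx ler01.
  - by rewrite in_itv/= lexx ler01.
  - exact: ler01.
rewrite /p /u !mul0r mul1r addr0 [a + h]addrC subrK.
lra.
Qed.

(** Integrals depending on a parameter are differentiated below through such
    quadratic error bounds, which can be integrated pointwise; no interchange of
    a limit with an integral is involved. *)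
Lemma is_derive_quadratic f (l C a : R) :
  (forall b, `|f b - f a - (b - a) * l| <= C * (b - a) ^+ 2) ->
  is_derive a 1 f l.
Proof.
move=> H.
have cv : h^-1 *: (f (h *: 1 + a) - f a) @[h --> (0:R)^'] --> l.
  apply/cvgrPdist_le => e e0; near=> h.
  have h0 : h != 0 by near: h; exact: nbhs_dnbhs_neq.
  have h1 : h *: (1 : R) = h by rewrite /GRing.scale/= mulr1.
  have {}H := H (h + a); rewrite addrK in H; rewrite h1.
  rewrite -[l](mulKf h0) -scalerBr normrM normfV.
  rewrite -ler_pdivlMl ?invr_gt0 ?normr_gt0//.
  rewrite invrK distrC (le_trans H)//.
  rewrite -real_normK ?num_real// expr2 mulrCA ler_wpM2l//.
  rewrite (@le_trans _ _ ((`|C| + 1) * `|h|))//.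
    by rewrite ler_wpM2r// (le_trans (ler_norm C))// lerDl.
  have M0 : 0 < `|C| + 1 by rewrite ltr_wpDl.
  rewrite mulrC -ler_pdivlMr//; near: h.
  apply: dnbhs0_le; exact: divr_gt0.
apply: DeriveDef; first by apply/cvg_ex; exists l.
exact/cvg_lim.
Unshelve. all: by end_near. Qed.

End calculus.

(** * Integrability *)

Section integrability.
Context d (T : measurableType d) (R : realType).
Implicit Types (D : set T) (u v : T -> R).

Lemma bounded_integrable (m : {measure set T -> \bar R}) D u (C : R) :
  measurable D -> (m D < +oo)%E -> measurable_fun D u ->
  (forall x, `|u x| <= C) -> m.-integrable D (EFin \o u).
Proof.
move=> mD Doo mu_ uC; apply: measurable_bounded_integrable => //.
exists C; split; first by rewrite num_real.
by move=> t Ct x _ /=; rewrite (le_trans (uC x))// ltW.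
Qed.

Lemma probability_bounded_integrable (P : probability T R) u (C : R) :
  measurable_fun setT u -> (forall x, `|u x| <= C) ->
  P.-integrable setT (EFin \o u).
Proof.
move=> mu_ uC; apply: bounded_integrable => //.
by apply: (le_lt_trans (probability_le1 P measurableT)); rewrite ltry.
Qed.

Lemma integrable_mul_bounded (m : {measure set T -> \bar R}) u v (C : R) :
  m.-integrable setT (EFin \o u) ->
  measurable_fun setT v -> (forall x, `|v x| <= C) ->
  m.-integrable setT (fun x => (u x * v x)%:E).
Proof.
move=> iu mv vC.
apply: (le_integrable measurableT _ _ (integrableZl measurableT C iu)).
  apply/measurable_EFinP; apply: measurable_funM => //.
  exact/measurable_EFinP/(measurable_int m).
move=> x _; rewrite lee_fin !normrM mulrC ler_wpM2r//.
by rewrite (le_trans (vC _))// ler_norm.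
Qed.

Lemma Rintegral_lincomb (m : {measure set T -> \bar R})
    (A B : T -> R) (a b : R) :
  m.-integrable setT (EFin \o A) -> m.-integrable setT (EFin \o B) ->
  m.-integrable setT (fun x => (a * A x - b * B x)%:E) /\
  \int[m]_x (a * A x - b * B x) = a * \int[m]_x A x - b * \int[m]_x B x.
Proof.
move=> iA iB; have ia := integrableZl measurableT a iA.
have ib := integrableZl measurableT b iB.
split; first exact: (integrableB measurableT ia ib).
by rewrite RintegralB// !RintegralZl.
Qed.

Lemma integrable_of_sqr (m : {finite_measure set T -> \bar R})
    (W : T -> R) :
  measurable_fun setT W ->
  m.-integrable setT (fun w => (W w ^+ 2)%:E) -> m.-integrable setT (EFin \o W).
Proof.
move=> mW iW2; have ic := finite_measure_integrable_cst m 1 measurableT.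
apply: (le_integrable measurableT _ _ (integrableD measurableT ic iW2)).
  exact/measurable_EFinP.
move=> w _; rewrite lee_fin /cst/= [leRHS]ger0_norm ?addr_ge0 ?sqr_ge0//.
have := sqr_ge0 (`|W w| - 1); have := normr_ge0 (W w).
by rewrite -[W w ^+ 2](real_normK (num_real (W w))) => *; nra.
Qed.

End integrability.

(** * The standard normal law *)

Section normal.
Context (R : realType).
Local Notation mu := (@lebesgue_measure R).
Local Notation N := (@normal_prob R 0 1).
Local Notation pdf := (@normal_pdf R 0 1).
Implicit Types f : R -> R.
Local Open Scope ereal_scope.

(** The normal law is defined through the integral of its density over sets;
    integrals of functions against it are reduced to Lebesgue integrals since
    the density is almost everywhere the Radon-Nikodym derivative. *)
Lemma integrable_normal_prob (f : R -> R) :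
  measurable_fun setT f -> mu.-integrable setT (fun x => (f x * pdf x)%:E) ->
  N.-integrable setT (EFin \o f) /\
  \int[N]_x (f x)%:E = \int[mu]_x (f x * pdf x)%:E.
Proof.
move=> mf ifp; have dom := normal_prob_dominates 0 1 : N `<< mu.
have mpdf : measurable_fun setT (EFin \o pdf).
  by apply/measurable_EFinP; exact: measurable_normal_pdf.
have RNE : ae_eq mu setT (Radon_Nikodym_SigmaFinite.f N mu) (EFin \o pdf).
  apply: integral_ae_eq => //.
    exact: Radon_Nikodym_SigmaFinite.f_integrable.
  by move=> E _ mE; rewrite -Radon_Nikodym_SigmaFinite.f_integral.
have mRN : measurable_fun setT (Radon_Nikodym_SigmaFinite.f N mu).
  apply: measurable_int; exact: Radon_Nikodym_SigmaFinite.f_integrable.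
have ge0_int g : measurable_fun setT g -> (forall x, 0 <= g x) ->
    \int[N]_x g x = \int[mu]_x (g x * (pdf x)%:E).
  move=> mg g0; rewrite -(Radon_Nikodym_SigmaFinite.change_of_variables dom)//.
  apply: ae_eq_integral => //; [exact: emeasurable_funM|exact: emeasurable_funM|].
  exact: ae_eqe_mul2l.
have mEf : measurable_fun setT (EFin \o f) by exact/measurable_EFinP.
have iN : N.-integrable setT (EFin \o f).
  apply/integrableP; split => //.
  rewrite (ge0_int (abse \o (EFin \o f)))//=; last exact: measurableT_comp.
  case/integrableP : ifp => _; apply: le_lt_trans.
  by under [leRHS]eq_integral do
    rewrite /= normrM (ger0_norm (normal_pdf_ge0 _ _ _)).
split => //; rewrite -(Radon_Nikodym_change_of_variables dom)//.
apply: ae_eq_integral => //.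
- by apply: emeasurable_funM => //; apply: (measurable_int mu).
- by under eq_fun do rewrite EFinM; exact: emeasurable_funM.
under [fun x : _ => (_ * pdf x)%:E]eq_fun do rewrite EFinM.
apply: ae_eqe_mul2l.
apply: ae_eq_trans RNE; apply: ae_eq_sym.
exact: ae_eq_Radon_Nikodym_SigmaFinite.
Qed.

Local Open Scope ring_scope.

Lemma normal_pdf01E (x : R) :
  pdf x = normal_peak 1 * expR (- (x ^+ 2) / 2).
Proof.
by rewrite normal_pdfE ?oner_eq0// /normal_fun subr0 expr1n mulr2n.
Qed.

Lemma is_derive_normal_pdf (x : R) : is_derive x 1 pdf (- x * pdf x).
Proof.
have -> : pdf = cst (normal_peak 1) * (expR \o (cst (- 2^-1) * id ^+ 2)).
  apply/funext => t /=; rewrite normal_pdf01E.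
  have -> : - t ^+ 2 / 2 = - 2^-1 * t ^+ 2 by ring.
  by [].
apply: trigger_derive.
by rewrite /GRing.scale/= /cst/= !fctE/=; field.
Qed.

Lemma normal_pdfN (x : R) : pdf (- x) = pdf x.
Proof. by rewrite !normal_pdf01E sqrrN. Qed.

Lemma cvg_normal_pdf_pinfty : pdf x @[x --> +oo%R] --> (0:R).
Proof.
have -> : pdf = (fun x => normal_peak 1 * gauss_fun (x * (Num.sqrt 2)^-1)).
  apply/funext => x; rewrite normal_pdf01E /gauss_fun; congr (_ * expR _).
  by rewrite exprMn exprVn sqr_sqrtr//; ring.
rewrite -[X in _ --> X](mulr0 (normal_peak (1:R))).
apply: cvgMr; apply: cvg_comp cvg_gauss_fun.
by apply: gt0_cvgMly; [rewrite invr_gt0 sqrtr_gt0|exact: cvg_id].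
Qed.

(** By symmetry only x pdf(x) on the positive half-line matters, and it is the
    derivative of - pdf. *)
Lemma integrable_norm_normal_pdf :
  mu.-integrable setT (fun x : R => (`|x| * pdf x)%:E).
Proof.
have cpdf : continuous pdf by apply: continuous_normal_pdf; exact: oner_neq0.
have mf : measurable_fun setT (fun x : R => `|x| * pdf x).
  apply: continuous_measurable_fun => x.
  by apply: cvgM; [exact: cvg_norm|exact: cpdf].
apply/integrableP; split; first exact/measurable_EFinP.
under eq_integral do rewrite /= ger0_norm ?mulr_ge0 ?normal_pdf_ge0//.
rewrite ge0_symfun_integralT; last 3 first.
- by move=> x; rewrite mulr_ge0 ?normal_pdf_ge0.
- by move=> x; apply: cvgM; [exact: cvg_norm|exact: cpdf].
- by move=> x /=; rewrite normrN normal_pdfN.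
rewrite (@eq_integral _ _ _ mu _ (fun x => (x * pdf x)%:E)); last first.
  by move=> x; rewrite inE/= => x0; rewrite ger0_norm.
rewrite -set_itvcy (@ge0_continuous_FTC2y R _ (- pdf) 0 (- 0))//.
- by rewrite -EFinB -EFinM ltry.
- by move=> x x0; rewrite mulr_ge0// normal_pdf_ge0.
- apply/continuous_subspaceT => x; apply: cvgM; [exact: cvg_id|exact: cpdf].
- by apply: cvgN; exact: cvg_normal_pdf_pinfty.
- by move=> x _; apply: derivableN; case: (is_derive_normal_pdf x).
- by apply: cvg_at_right_filter; apply: cvgN; exact: cpdf.
- move=> x _; rewrite derive1E.
  have [d e] := is_derive_normal_pdf x.
  by rewrite deriveN// e mulNr opprK.
Qed.

Lemma integrable_normal_norm : N.-integrable setT (fun z : R => `|z|%:E).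
Proof.
have := integrable_norm_normal_pdf => ip.
have mn : measurable_fun setT (fun z : R => `|z|).
  by apply: continuous_measurable_fun => z; exact: cvg_norm.
exact: (integrable_normal_prob mn ip).1.
Qed.

Lemma integrable_normal_lipschitz f (M : R) :
  (forall x y, `|f x - f y| <= M * `|x - y|) -> N.-integrable setT (EFin \o f).
Proof.
move=> fM; have iM := integrableZl measurableT M integrable_normal_norm.
have ic := finite_measure_integrable_cst N `|f 0| measurableT.
apply: (le_integrable measurableT _ _ (integrableD measurableT ic iM)).
  apply/measurable_EFinP; apply: continuous_measurable_fun.
  exact: lipschitz_continuous fM.
move=> x _; rewrite lee_fin [leRHS]ger0_norm; last first.
  by rewrite addr_ge0// (le_trans _ (le_trans (fM x 0) _))// subr0.
have := fM x 0; rewrite subr0 => fx.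
by rewrite /cst/= -lerBlDl (le_trans _ fx)// lerB_dist.
Qed.

(** The integrand x f(x) - f'(x), weighted by the density, is the derivative
    of - f pdf, which vanishes at both ends since f is bounded. Its integrals
    over [-n, n] thus tend to 0, and by domination they also tend to the
    integral over the whole line. *)
Lemma stein_integration_by_parts (f : R -> R) (M : R) :
  (forall x, derivable f x 1) -> continuous f^`()%classic ->
  (forall x, `|f x| <= M) -> (forall x, `|f^`()%classic x| <= M) ->
  N.-integrable setT (fun x => (x * f x)%:E) /\
  \int[N]_x (x * f x) = \int[N]_x f^`()%classic x.
Proof.
move=> df cf' fM f'M; have cf := derivableT_continuous df.
have cpdf : continuous pdf by apply: continuous_normal_pdf; exact: oner_neq0.
have cid : continuous (fun x : R => x) by move=> x; exact: cvg_id.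
have M0 : 0 <= M := le_trans (normr_ge0 _) (fM 0).
have ixf : mu.-integrable setT (fun x : R => (x * f x * pdf x)%:E).
  have := integrableZl measurableT M integrable_norm_normal_pdf.
  apply: le_integrable => //.
    apply/measurable_EFinP; apply: continuous_measurable_fun => x.
    by apply: cvgM; [apply: cvgM; [exact: cid|exact: cf]|exact: cpdf].
  move=> x _; rewrite lee_fin [leRHS]normrM !normrM normr_id (ger0_norm M0).
  by rewrite mulrA ler_wpM2r// mulrC ler_wpM2r.
have if' : mu.-integrable setT (fun x : R => (f^`()%classic x * pdf x)%:E).
  have := integrableZl measurableT M (integrable_normal_pdf 0 1).
  apply: le_integrable => //.
    apply/measurable_EFinP; apply: continuous_measurable_fun => x.
    by apply: cvgM; [exact: cf'|exact: cpdf].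
  move=> x _; rewrite lee_fin [leRHS]normrM !normrM (ger0_norm M0).
  by rewrite ler_wpM2r.
have mxf : measurable_fun setT (fun x : R => x * f x).
  by apply: continuous_measurable_fun => x; apply: cvgM; [exact: cid|exact: cf].
have mf' : measurable_fun setT f^`()%classic by exact: continuous_measurable_fun.
have [iN1 e1] := integrable_normal_prob mxf ixf.
have [_ e2] := integrable_normal_prob mf' if'.
split => //; rewrite /Rintegral e1 e2; apply/eqP.
rewrite -subr_eq0 -fineB; [|exact: integrable_fin_num|exact: integrable_fin_num].
rewrite -integralB//=.
pose g (x : R) := x * f x * pdf x - f^`()%classic x * pdf x.
have cg : continuous g.
  move=> x; apply: cvgB; apply: cvgM; [|exact: cpdf|exact: cf'|exact: cpdf].
  by apply: cvgM; [exact: cid|exact: cf].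
have ig : mu.-integrable setT (EFin \o g).
  exact: (integrableB measurableT ixf if').
have dF (x : R) : is_derive x 1 (- (f * pdf)) (g x).
  have dfx : is_derive x 1 f (f^`()%classic x).
    by rewrite derive1E; exact/derivableP.
  apply: (is_derive_eq (is_deriveN (is_deriveM dfx (is_derive_normal_pdf x)))).
  by rewrite /GRing.scale/= /g; ring.
have cF : continuous (- (f * pdf)).
  by apply: derivableT_continuous => x; case: (dF x).
pose I (n : nat) : set R := `[- n.+1%:R, n.+1%:R]%classic.
have intg (n : nat) : (\int[mu]_(x in I n) (g x)%:E =
    (f (- n.+1%:R) * pdf n.+1%:R - f n.+1%:R * pdf n.+1%:R)%:E)%E.
  rewrite (@continuous_FTC2 _ g (- (f * pdf))).
  - by rewrite -EFinB !fctE normal_pdfN opprK addrC.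
  - by rewrite gtrN.
  - exact: continuous_subspaceT.
  - split; first by move=> x _; case: (dF x).
      by apply: cvg_at_right_filter; exact: cF.
    by apply: cvg_at_left_filter; exact: cF.
  - by move=> x _; rewrite derive1E (@derive_val _ _ _ _ _ _ _ (dF x)).
(* the boundary terms at n and -n are at most 2 M times the density at n *)
have cvg0 : (\int[mu]_(x in I n) (g x)%:E)%E @[n --> \oo] --> 0%:E.
  under eq_fun do rewrite intg.
  apply: cvg_EFin; first by apply: nearW.
  have pn0 : M *+ 2 * pdf n.+1%:R @[n --> \oo] --> (0 : R).
    rewrite -[X in _ --> X](mulr0 (M *+ 2)); apply: cvgMr.
    apply: (@cvg_comp _ _ _ (fun n : nat => n.+1%:R : R)) cvg_normal_pdf_pinfty.
    by rewrite (cvg_shiftS (fun n => n%:R : R)); exact: cvgr_idn.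
  apply/cvgr0Pnorm_le => e e0; near=> n.
  apply: (@le_trans _ _ (M *+ 2 * pdf n.+1%:R)).
    rewrite /= -mulrBl normrM (ger0_norm (normal_pdf_ge0 _ _ _)).
    rewrite ler_wpM2r ?normal_pdf_ge0// mulr2n (le_trans (ler_normB _ _))//.
    exact: lerD.
  apply: le_trans (ler_norm _) _; near: n.
  by move: e e0; apply/cvgr0Pnorm_le.
have cvgI : (\int[mu]_(x in I n) (g x)%:E)%E @[n --> \oo] -->
    (\int[mu]_x (g x)%:E)%E.
  under eq_fun do rewrite integral_mkcond.
  apply: (@dominated_cvg _ _ _ mu _ measurableT
    (fun n => (EFin \o g) \_ (I n)) _ (abse \o (EFin \o g))) => //.
  - move=> n; apply: (measurable_int mu).
    apply: (integrable_mkcond _ _).1; first exact: measurable_itv.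
    by apply: integrableS ig => //; exact: measurable_itv.
  - move=> x _; apply: cvg_near_cst; near=> n.
    rewrite patchE mem_set// /I/= in_itv/= -ler_norml.
    apply: (@le_trans _ _ n%:R); last by rewrite ler_nat.
    by near: n; exact: nbhs_infty_ger.
  - exact: integrable_abse.
  - by move=> n x _; rewrite patchE; case: ifPn => _ //=; rewrite normr0 lee_fin.
rewrite -[X in fine X]/(\int[mu]_x (g x)%:E)%E.
by rewrite (cvg_unique _ cvgI cvg0).
Unshelve. all: by end_near. Qed.

Lemma Rintegral_normal_cst (r : R) : \int[N]_z r = r.
Proof.
by rewrite Rintegral_cst//= -[N _]/(N [set: _]) probability_setT mulr1.
Qed.

End normal.

(** * Averages over rotations *)

Section arc.
Context (R : realType).
Local Notation mu := (@lebesgue_measure R).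
Local Notation N := (@normal_prob R 0 1).
Local Notation Q := (mu \x N)%E.
Local Notation arc := (`[0, pi / 2]%classic : set (measurableTypeR R)).
Local Notation strip := (arc `*` [set: measurableTypeR R]).
Local Notation RR := (measurableTypeR R * measurableTypeR R)%type.
Implicit Types f : R -> R.
Local Open Scope ring_scope.

Lemma measurable_strip : measurable (strip : set RR).
Proof. by apply: measurableX => //; exact: measurable_itv. Qed.

Lemma pihalf_gt0 : 0 < pi / 2 :> R.
Proof. by rewrite divr_gt0// pi_gt0. Qed.

Lemma strip_lty : (Q strip < +oo)%E.
Proof.
have -> : Q strip = (mu arc * N setT)%E.
  by apply: product_measure1E => //; exact: measurable_itv.
rewrite -[N _]/(N [set: _]) probability_setT mule1 lebesgue_measure_itv/=.
by case: ifP => _; rewrite -?EFinB ltry.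
Qed.

Lemma integrable_strip (u : RR -> R) (C : R) :
  measurable_fun setT u -> (forall p, `|u p| <= C) ->
  Q.-integrable strip (EFin \o u).
Proof.
move=> mu_ uC; apply: bounded_integrable uC.
- exact: measurable_strip.
- exact: strip_lty.
- exact: measurable_funTS.
Qed.

Lemma Rintegral_strip_arcN (u : RR -> R) :
  Q.-integrable strip (EFin \o u) ->
  (forall t, arc t -> N.-integrable setT (fun z => (u (t, z))%:E)) ->
  \int[Q]_(p in strip) u p = \int[mu]_(t in arc) \int[N]_z u (t, z).
Proof.
move=> iu iN; congr fine.
rewrite integral_mkcond -integral12_prod_meas1; last first.
  by apply: (integrable_mkcond _ _).1 => //; exact: measurable_strip.
rewrite [RHS]integral_mkcond; apply: eq_integral => t _.
rewrite /fubini_F [RHS]patchE; case: ifPn => [|tarc].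
  rewrite inE => tarc; rewrite /Rintegral fineK; last first.
    by apply: integrable_fin_num => //; exact: iN.
  by apply: eq_integral => z _; rewrite patchE mem_set.
apply: integral0_eq => z _; rewrite patchE ifN//.
by apply: contra tarc; rewrite !inE => -[].
Qed.

Lemma Rintegral_strip_Narc (u : RR -> R) :
  Q.-integrable strip (EFin \o u) ->
  (forall z, mu.-integrable arc (fun t => (u (t, z))%:E)) ->
  \int[Q]_(p in strip) u p = \int[N]_z \int[mu]_(t in arc) u (t, z).
Proof.
move=> iu iN; congr fine.
rewrite integral_mkcond -integral21_prod_meas1; last first.
  by apply: (integrable_mkcond _ _).1 => //; exact: measurable_strip.
apply: eq_integral => z _; rewrite /fubini_G /Rintegral fineK; last first.
  by apply: integrable_fin_num => //; exact: measurable_itv.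
rewrite [RHS]integral_mkcond; apply: eq_integral => t _.
rewrite !patchE; congr (if _ then _ else _).
by apply/idP/idP; rewrite !inE => // -[].
Qed.

Lemma Rintegral_arc (F f : R -> R) : continuous f ->
  (forall t : R, is_derive t 1 F (f t)) ->
  \int[mu]_(t in arc) f t = F (pi / 2) - F 0.
Proof.
move=> cf dF.
have cF : continuous F.
  by apply: derivableT_continuous => t; case: (dF t).
rewrite /Rintegral (@continuous_FTC2 R f F) ?pihalf_gt0//.
- exact: continuous_subspaceT.
- split; first by move=> x _; case: (dF x).
    by apply: cvg_at_right_filter; exact: cF.
  by apply: cvg_at_left_filter; exact: cF.
- by move=> x _; rewrite derive1E (@derive_val _ _ _ _ _ _ _ (dF x)).
Qed.

Lemma integrable_arc f : continuous f -> mu.-integrable arc (EFin \o f).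
Proof.
move=> cf; apply: continuous_compact_integrable; first exact: segment_compact.
exact: continuous_subspaceT.
Qed.

Lemma measurable_comp_fst f : continuous f ->
  measurable_fun setT (fun p : RR => f p.1).
Proof.
move=> cf; apply: (@measurableT_comp _ _ _ _ _ _ f _ fst) => //.
exact: continuous_measurable_fun.
Qed.

Definition weight k (p : RR) : R := cos p.1 * sin p.1 ^+ k.

Lemma continuous_cossinX k : continuous (fun t : R => cos t * sin t ^+ k).
Proof.
move=> t; apply: cvgM; first exact: continuous_cos.
apply: (@continuous_comp _ _ _ (@sin R) (fun y => y ^+ k)).
  exact: continuous_sin.
exact: exprn_continuous.
Qed.

Lemma measurable_weight k : measurable_fun setT (weight k).
Proof.
exact: (@measurable_comp_fst (fun t => cos t * sin t ^+ k) (@continuous_cossinX k)).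
Qed.

Lemma weight_norm k p : `|weight k p| <= 1.
Proof.
rewrite normrM normrX mulr_ile1// ?exprn_ge0 ?cos_max// exprn_ile1//.
exact: sin_max.
Qed.

Lemma sin_ge0_strip p : strip p -> 0 <= sin p.1.
Proof.
case=> /=; rewrite in_itv/= => /andP[t0 tp] _.
by rewrite sin_ge0_pi// t0/= (le_trans tp)// ler_pdivrMr// ler_pMr ?pi_gt0// ler1n.
Qed.

Lemma weight_ge0 k p : strip p -> 0 <= weight k p.
Proof.
move=> sp; rewrite mulr_ge0 ?exprn_ge0 ?sin_ge0_strip//.
case: sp => /=; rewrite in_itv/= => /andP[t0 tp] _.
by rewrite cos_ge0_pihalf// tp andbT (le_trans _ t0)// oppr_le0 ltW ?pihalf_gt0.
Qed.

Lemma integral_weight k : \int[Q]_(p in strip) weight k p = k.+1%:R^-1.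
Proof.
rewrite Rintegral_strip_arcN.
- under eq_Rintegral => t _.
    rewrite [X in Rintegral _ _ X](_ : _ = cst (cos t * sin t ^+ k))//.
    rewrite Rintegral_normal_cst.
    over.
  have dF (t : R) : is_derive t 1 (k.+1%:R^-1 \*: (@sin R ^+ k.+1))
      (cos t * sin t ^+ k).
    have dk := is_deriveZ k.+1%:R^-1 (is_deriveX k.+1 (is_derive_sin t)).
    apply: (is_derive_eq dk); rewrite /GRing.scale/=.
    by rewrite -mulrA mulKf ?pnatr_eq0// mulrC.
  rewrite (Rintegral_arc (@continuous_cossinX k) dF) !fctE/=.
  by rewrite sin_pihalf sin0 expr1n expr0n/= scaler0 subr0 /GRing.scale/= mulr1.
- exact: integrable_strip (measurable_weight k) (weight_norm k).
- by move=> t _; exact: (finite_measure_integrable_cst N (weight k (t, 0))).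
Qed.

(** All estimates on arc averages are instances of this one: a pointwise bound
    by a multiple of the weight. *)
Lemma Rintegral_weight_le k (u : RR -> R) (C : R) :
  Q.-integrable strip (EFin \o u) ->
  (forall p, strip p -> `|u p| <= C * weight k p) ->
  `|\int[Q]_(p in strip) u p| <= C / k.+1%:R.
Proof.
move=> iu uC; have iw := integrable_strip (measurable_weight k) (weight_norm k).
rewrite (le_trans (le_normr_Rintegral measurable_strip iu))//.
have <- : \int[Q]_(p in strip) (C * weight k p) = C / k.+1%:R.
  by rewrite RintegralZl ?integral_weight//; exact: measurable_strip.
apply: (le_Rintegral measurable_strip) => //.
- exact: integrable_norm.
- exact: (integrableZl measurable_strip C iw).
Qed.

(** The second component of p will be standard normal, and the first an angle
    from 0, where the value is that normal variable, to pi/2, where it is x. This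
    is the Ornstein-Uhlenbeck interpolation s x + sqrt(1 - s^2) z, made smooth at
    s = 1 by setting s to the sine of the angle. *)
Definition rot x (p : RR) : R := x * sin p.1 + p.2 * cos p.1.

Lemma measurable_rot x : measurable_fun setT (rot x).
Proof.
apply: measurable_funD; apply: measurable_funM => //.
- exact: measurable_comp_fst (@continuous_sin R).
- exact: measurable_comp_fst (@continuous_cos R).
Qed.

(** The weight cos sin^k is what the k-th differentiation in x leaves behind;
    its mass 1/(k+1) is the constant in every bound below. *)
Definition arc_average k f x : R :=
  \int[Q]_(p in strip) (weight k p * f (rot x p)).

Lemma integrable_arc_average k f x (C : R) :
  measurable_fun setT f -> (forall y, `|f y| <= C) ->
  Q.-integrable strip (fun p => (weight k p * f (rot x p))%:E).
Proof.
move=> mf fC; apply: (@integrable_strip _ C).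
  apply: measurable_funM; first exact: measurable_weight.
  exact: measurableT_comp (measurable_rot x).
move=> p; rewrite normrM -[C]mul1r.
by rewrite ler_pM// weight_norm.
Qed.

Lemma arc_average_bounded k f (C : R) :
  measurable_fun setT f -> (forall y, `|f y| <= C) ->
  forall x, `|arc_average k f x| <= C / k.+1%:R.
Proof.
move=> mf fC x; apply: Rintegral_weight_le.
  exact: integrable_arc_average fC.
move=> p sp; rewrite normrM (ger0_norm (weight_ge0 _ sp)) mulrC.
by rewrite ler_wpM2r// weight_ge0.
Qed.

Lemma rotB x y p : rot x p - rot y p = (x - y) * sin p.1.
Proof. by rewrite /rot opprD addrACA subrr addr0 -mulrBl. Qed.

Lemma weightS k p : weight k.+1 p = weight k p * sin p.1.
Proof. by rewrite /weight exprSr mulrA. Qed.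

(** A displacement of x is damped by the factor sin, which raises the weight by
    one and turns 1/(k+1) into 1/(k+2). *)
Lemma arc_average_lipschitz k f (C M : R) :
  measurable_fun setT f -> (forall y, `|f y| <= C) ->
  (forall x y, `|f x - f y| <= M * `|x - y|) ->
  forall x y, `|arc_average k f x - arc_average k f y| <= M / k.+2%:R * `|x - y|.
Proof.
move=> mf fC fM x y; rewrite /arc_average -RintegralB; last 3 first.
- exact: measurable_strip.
- exact: integrable_arc_average fC.
- exact: integrable_arc_average fC.
rewrite mulrAC; apply: Rintegral_weight_le.
  have ia z := integrable_arc_average k z mf fC.
  exact: (integrableB measurable_strip (ia x) (ia y)).
move=> p sp; rewrite -mulrBr normrM (ger0_norm (weight_ge0 _ sp)) weightS.
rewrite (le_trans (ler_wpM2l (weight_ge0 _ sp) (fM _ _)))// rotB normrM.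
rewrite (ger0_norm (sin_ge0_strip sp)) le_eqVlt; apply/orP; left; apply/eqP.
ring.
Qed.

(** Each differentiation in x brings out one more factor sin. The Taylor
    estimate is integrated pointwise: its remainder carries sin^2, whence the
    weight k+2 and the factor 1/(k+3). *)
Lemma arc_average_taylor k f (C M : R) :
  (forall x, derivable f x 1) ->
  (forall x, `|f x| <= C) -> (forall x, `|f^`()%classic x| <= C) ->
  (forall x y, `|f^`()%classic x - f^`()%classic y| <= M * `|x - y|) ->
  forall a b, `|arc_average k f b - arc_average k f a -
    (b - a) * arc_average k.+1 f^`()%classic a| <=
    M / 2 / k.+3%:R * (b - a) ^+ 2.
Proof.
move=> df fC f'C f'M a b.
have mf : measurable_fun setT f.
  by apply: continuous_measurable_fun; exact: derivableT_continuous.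
have mf' : measurable_fun setT f^`()%classic.
  by apply: continuous_measurable_fun; exact: lipschitz_continuous f'M.
have ia := integrable_arc_average k a mf fC.
have ib := integrable_arc_average k b mf fC.
have ia' := integrable_arc_average k.+1 a mf' f'C.
have iba := integrableB measurable_strip ib ia.
have iZ := integrableZl measurable_strip (b - a) ia'.
rewrite /arc_average -RintegralB//; last exact: measurable_strip.
rewrite -RintegralZl//; last exact: measurable_strip.
rewrite -RintegralB//; last exact: measurable_strip.
rewrite mulrAC; apply: Rintegral_weight_le.
  exact: (integrableB measurable_strip iba iZ).
move=> p sp; rewrite !weightS.
have := taylor1_lipschitz df f'M (rot a p) (rot b p); rewrite rotB => H.
rewrite [X in `|X|](_ : _ = weight k p * (f (rot b p) - f (rot a p) -
  (b - a) * sin p.1 * f^`()%classic (rot a p))); last by ring.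
rewrite normrM (ger0_norm (weight_ge0 _ sp)).
rewrite (le_trans (ler_wpM2l (weight_ge0 _ sp) H))//.
rewrite le_eqVlt; apply/orP; left; apply/eqP; ring.
Qed.

End arc.

(** * The Stein equation *)

Section stein_equation.
Context (R : realType).
Local Notation mu := (@lebesgue_measure R).
Local Notation N := (@normal_prob R 0 1).
Local Notation Q := (mu \x N)%E.
Local Notation arc := (`[0, pi / 2]%classic : set (measurableTypeR R)).
Local Notation strip := (arc `*` [set: measurableTypeR R]).
Local Notation RR := (measurableTypeR R * measurableTypeR R)%type.
Implicit Types f : R -> R.
Local Open Scope ring_scope.

Lemma integrable_strip_snd (v : R -> R) : N.-integrable setT (EFin \o v) ->
  Q.-integrable strip (fun p => (v p.2)%:E).
Proof.
move=> iv; have mv := measurable_int _ iv.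
have m2 : measurable_fun setT (fun p : RR => (v p.2)%:E).
  exact: (measurableT_comp mv).
have mstrip := @measurable_strip R.
apply/(integrable_mkcond _ mstrip).
apply/integrable21ltyP.
  exact/(measurable_restrictT _ mstrip)/measurable_funTS.
have e z : (\int[mu]_t `|((fun p : RR => (v p.2)%:E) \_ strip) (t, z)| =
    (pi / 2)%:E * `|(v z)%:E|)%E.
  transitivity (\int[mu]_(t in arc) `|(v z)%:E|)%E; last first.
    rewrite integral_cst//= muleC.
    by rewrite lebesgue_measure_itv/= lte_fin pihalf_gt0 -EFinB subr0.
  rewrite [RHS]integral_mkcond; apply: eq_integral => t _.
  rewrite !patchE; case: ifPn => [|ts].
    by rewrite inE => -[/= ta _]; rewrite mem_set.
  rewrite abse0 ifN//; apply: contra ts; rewrite !inE => ta; by split.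
rewrite (@eq_integral _ _ _ N _ (fun z => (pi / 2)%:E * `|(v z)%:E|)%E);
  last by move=> z _; exact: e.
rewrite ge0_integralZl//.
- by case/integrableP : iv => _ iv; rewrite lte_mul_pinfty// lee_fin ltW ?pihalf_gt0.
- exact: measurableT_comp.
- by rewrite lee_fin ltW ?pihalf_gt0.
Qed.

Lemma is_derive_rot1 (x z t : R) :
  is_derive t 1 (fun t : R => rot x (t, z)) (x * cos t - z * sin t).
Proof.
have -> : (fun t => rot x (t, z)) = x \*: @sin R + z \*: @cos R by [].
apply: (is_derive_eq (is_deriveD (is_deriveZ x (is_derive_sin t))
  (is_deriveZ z (is_derive_cos t)))).
by rewrite /GRing.scale/= mulrN.
Qed.

Lemma is_derive_rot2 (x t z : R) :
  is_derive z 1 (fun z : R => rot x (t, z)) (cos t).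
Proof.
have -> : (fun z => rot x (t, z)) = cst (x * sin t) + cos t \*: id.
  by apply/funext => y; rewrite /rot/= mulrC (mulrC y).
apply: (is_derive_eq (is_deriveD (is_derive_cst _ z 1)
  (is_deriveZ (cos t) (is_derive_id z 1)))).
by rewrite add0r /GRing.scale/= mulr1.
Qed.

Lemma continuous_rot1 (x z : R) : continuous (fun t : R => rot x (t, z) : R).
Proof. by apply: derivableT_continuous => t; case: (is_derive_rot1 x z t). Qed.

Lemma continuous_rot2 (x t : R) : continuous (fun z : R => rot x (t, z) : R).
Proof. by apply: derivableT_continuous => z; case: (is_derive_rot2 x t z). Qed.

(** f(x) - f(z) is the integral over the quarter circle of the derivative of
    f along the rotation from z to x. After averaging over z, the term in
    which z occurs as a factor is transformed by Gaussian integration by parts,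
    and both remaining terms are arc averages. *)
Lemma stein_equation f (C : R) :
  (forall x, derivable f x 1) -> (forall x, derivable f^`()%classic x 1) ->
  continuous f^`()^`()%classic ->
  (forall x, `|f^`()%classic x| <= C) ->
  (forall x, `|f^`()^`()%classic x| <= C) ->
  forall x, f x - \int[N]_z f z =
    x * arc_average 0 f^`()%classic x - arc_average 1 f^`()^`()%classic x.
Proof.
move=> df df' cf'' f'C f''C x.
set f' := f^`()%classic; set f'' := f'^`()%classic.
have cf' : continuous f' := derivableT_continuous df'.
have mf' : measurable_fun setT f' by exact: continuous_measurable_fun.
have mf'' : measurable_fun setT f'' by exact: continuous_measurable_fun.
have iN : N.-integrable setT (EFin \o f).
  exact/integrable_normal_lipschitz/bounded_derive1_lipschitz.
(* u is the derivative of f along the rotation; v is u after the Gaussian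
   integration by parts *)
pose u (p : RR) := f' (rot x p) * (x * cos p.1 - p.2 * sin p.1).
pose v (p : RR) := x * (weight 0 p * f' (rot x p)) - weight 1 p * f'' (rot x p).
have mrot := @measurable_rot R x.
have iu : Q.-integrable strip (EFin \o u).
  have idom := integrable_strip_snd
    (integrableZl measurableT C
      (integrableD measurableT (finite_measure_integrable_cst N `|x| measurableT)
        (integrable_normal_norm R))).
  have mz : measurable_fun setT (fun p : RR => x * cos p.1 - p.2 * sin p.1).
    apply: measurable_funB; apply: measurable_funM => //.
      exact: measurable_comp_fst (@continuous_cos R).
    exact: measurable_comp_fst (@continuous_sin R).
  apply: (le_integrable (@measurable_strip R) _ _ idom).
    apply/measurable_EFinP/measurable_funTS; apply: measurable_funM => //.
    exact: measurableT_comp mf' mrot.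
  move=> p _; rewrite lee_fin.
  have C0 : 0 <= C by exact: le_trans (f'C 0).
  rewrite [leRHS]ger0_norm ?mulr_ge0 ?addr_ge0// normrM.
  rewrite ler_pM// (le_trans (ler_normB _ _))// !normrM lerD//.
    by rewrite ler_piMr// cos_max.
  by rewrite ler_piMr// sin_max.
have iv0 : Q.-integrable strip (fun p => (x * (weight 0 p * f' (rot x p)))%:E).
  have i0 := integrable_arc_average 0 x mf' f'C.
  exact: (integrableZl (@measurable_strip R) x i0).
have iv1 := integrable_arc_average 1 x mf'' f''C.
have iv : Q.-integrable strip (EFin \o v).
  exact: (integrableB (@measurable_strip R) iv0 iv1).
have iA (t : R) g : continuous g -> (forall y, `|g y| <= C) ->
    N.-integrable setT (fun z => (g (rot x (t, z)))%:E).
  move=> cg gC; apply: (@probability_bounded_integrable _ _ _ N _ C) => //.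
  apply: continuous_measurable_fun => z.
  apply: (@continuous_comp _ _ _ (fun z => rot x (t, z)) g).
    exact: continuous_rot2.
  exact: cg.
have ibp (t : R) : N.-integrable setT (fun z => (z * f' (rot x (t, z)))%:E) /\
    \int[N]_z (z * f' (rot x (t, z))) = cos t * \int[N]_z f'' (rot x (t, z)).
  have d (z : R) : is_derive z 1 (fun z => f' (rot x (t, z)))
      (cos t * f'' (rot x (t, z))).
    have dfr : is_derive (rot x (t, z)) 1 f' (f'' (rot x (t, z))).
      by rewrite /f'' derive1E; exact/derivableP.
    have := @is_derive1_comp _ f' (fun z : R => rot x (t, z)) z _ _ dfr
      (is_derive_rot2 x t z).
    by move=> /is_derive_eq; apply; rewrite mulrC.
  have e : (fun z => f' (rot x (t, z)))^`()%classic =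
      (fun z => cos t * f'' (rot x (t, z))).
    apply/funext => z; rewrite derive1E; exact: (@derive_val _ _ _ _ _ _ _ (d z)).
  have <- := RintegralZl (cos t) measurableT (iA t _ cf'' f''C).
  rewrite -e; apply: (@stein_integration_by_parts _ _ C).
  - by move=> z; case: (d z).
  - rewrite e => z; apply: cvgM; first exact: cvg_cst.
    apply: (@continuous_comp _ _ _ (fun z => rot x (t, z)) f'').
      exact: continuous_rot2.
    exact: cf''.
  - by move=> z; exact: f'C.
  - by move=> z; rewrite e normrM -[C]mul1r ler_pM// cos_max.
have cu (z : R) : continuous (fun t => u (t, z)).
  move=> t; apply: cvgM.
    apply: (@continuous_comp _ _ _ (fun t => rot x (t, z)) f').
      exact: continuous_rot1.
    exact: cf'.
  apply: cvgB; apply: cvgM; [exact: cvg_cst|exact: continuous_cos|exact: cvg_cst|].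
  exact: continuous_sin.
have uE t z : u (t, z) = x * cos t * f' (rot x (t, z)) -
    sin t * (z * f' (rot x (t, z))) by rewrite /u/=; ring.
have vE t z : v (t, z) = x * cos t * f' (rot x (t, z)) -
    (sin t * cos t) * f'' (rot x (t, z)).
  by rewrite /v /weight/= expr0 expr1; ring.
transitivity (\int[N]_z \int[mu]_(t in arc) u (t, z)).
  transitivity (\int[N]_z (f x - f z)).
    rewrite RintegralB//; last exact: (finite_measure_integrable_cst N (f x)).
    by rewrite Rintegral_normal_cst.
  apply: eq_Rintegral => z _; apply/esym.
  have dF (t : R) : is_derive t 1 (fun t => f (rot x (t, z))) (u (t, z)).
    have dfr : is_derive (rot x (t, z)) 1 f (f' (rot x (t, z))).
      by rewrite /f' derive1E; exact/derivableP.
    exact: @is_derive1_comp _ f (fun t : R => rot x (t, z)) t _ _ dfr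
      (is_derive_rot1 x z t).
  rewrite (Rintegral_arc (cu z) dF).
  by rewrite /rot/= sin_pihalf cos_pihalf sin0 cos0 !mulr0 !mulr1 addr0 add0r.
rewrite -Rintegral_strip_Narc//; last by move=> z; exact: integrable_arc (cu z).
transitivity (\int[Q]_(p in strip) v p).
  have iAt t := iA t _ cf' f'C; have iBt t := iA t _ cf'' f''C.
  have Lu t := Rintegral_lincomb (x * cos t) (sin t) (iAt t) (ibp t).1.
  have Lv t := Rintegral_lincomb (x * cos t) (sin t * cos t) (iAt t) (iBt t).
  have iNu t : N.-integrable setT (fun z => (u (t, z))%:E).
    by under eq_fun do rewrite uE; exact: (Lu t).1.
  have iNv t : N.-integrable setT (fun z => (v (t, z))%:E).
    by under eq_fun do rewrite vE; exact: (Lv t).1.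
  rewrite (Rintegral_strip_arcN iu (fun t _ => iNu t)).
  rewrite (Rintegral_strip_arcN iv (fun t _ => iNv t)).
  apply: eq_Rintegral => t _.
  under eq_Rintegral do rewrite uE.
  under [RHS]eq_Rintegral do rewrite vE.
  by rewrite (Lu t).2 (Lv t).2 (ibp t).2 mulrA.
rewrite /v RintegralB//; [|exact: measurable_strip].
rewrite RintegralZl//; first exact: measurable_strip.
exact: integrable_arc_average f'C.
Qed.

End stein_equation.

(** * Conditional expectation *)

Section conditional_expectation.
Context d (T : measurableType d) (R : realType).
Implicit Type m : {measure set T -> \bar R}.
Local Notation RM := (measurableTypeR R).
Local Open Scope ereal_scope.
Import HBNNSimple.

Lemma integral_preimage_eq0_nnsfun m (U : T -> R) (W : T -> RM)
    (s : {nnsfun RM >-> R}) :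
  measurable_fun setT W -> m.-integrable setT (EFin \o U) ->
  (forall B, measurable B -> \int[m]_(x in W @^-1` B) (U x)%:E = 0) ->
  \int[m]_x (U x * s (W x))%:E = 0.
Proof.
move=> mW iU U0.
have mWV B : measurable B -> measurable (W @^-1` B).
  by move=> mB; rewrite -[X in measurable X]setTI; exact: mW.
pose V r := (EFin \o U) \_ (W @^-1` (s @^-1` [set r])).
have mV r : measurable (W @^-1` (s @^-1` [set r])) by exact/mWV/measurable_sfunP.
have iV r : m.-integrable setT (V r).
  by apply: (integrable_mkcond _ (mV r)).1; exact: integrableS iU.
under eq_integral => x _.
  rewrite fimfunE fsbig_finite//= mulr_sumr -sumEFin.
  under eq_bigr => r _.
    rewrite (_ : (U x * _)%:E = r%:E * V r x); first over.
    rewrite /V patchE indicE.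
    have -> : (W x \in s @^-1` [set r]) = (x \in W @^-1` (s @^-1` [set r])).
      by apply/idP/idP; rewrite !inE.
    by case: (x \in _); rewrite ?mulr1 ?mulr0 ?mule0 -?EFinM//= mulrC.
  over.
rewrite integral_sum//; last by move=> r; exact: integrableZl.
apply: big1 => r _; rewrite integralZl//.
by rewrite /V -integral_mkcond U0 ?mule0//; exact: measurable_sfunP.
Qed.

(** U integrates to 0 against indicators of W, hence against simple functions
    of W, hence by domination against bounded functions of W. The constant C is
    added to k so that it is approximated from below by simple functions. *)
Lemma integral_preimage_eq0 m (U : T -> R) (W : T -> RM) (k : R -> R) (C : R) :
  measurable_fun setT W -> m.-integrable setT (EFin \o U) ->
  (forall B, measurable B -> \int[m]_(x in W @^-1` B) (U x)%:E = 0) ->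
  measurable_fun setT k -> (forall y, (`|k y| <= C)%R) ->
  \int[m]_x (U x * k (W x))%:E = 0.
Proof.
move=> mW iU U0 mk kC.
have mU : measurable_fun setT U by exact/measurable_EFinP/(measurable_int m).
have mkC : measurable_fun [set: RM] (fun y => (k y + C)%:E).
  by apply/measurable_EFinP; exact: measurable_funD.
have kC0 (y : RM) : [set: RM] y -> 0 <= (k y + C)%:E.
  move=> _; rewrite lee_fin -lerBlDr sub0r.
  by have /ler_normlP[] := kC y; rewrite lerNl.
pose s := nnsfun_approx measurableT mkC.
have sC n y : (`|s n y| <= C *+ 2)%R.
  rewrite ger0_norm//; have := le_approx n kC0 (I : setT y).
  rewrite /s nnsfun_approxE lee_fin => /le_trans; apply.
  by rewrite mulr2n lerD2r (le_trans (ler_norm _)).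
have U0T : \int[m]_x (U x)%:E = 0 by rewrite -(U0 setT).
have iUk : m.-integrable setT (fun x => (U x * k (W x))%:E).
  have mkW : measurable_fun setT (k \o W) by exact: measurableT_comp mk mW.
  exact: (integrable_mul_bounded iU mkW (fun x => kC (W x))).
have cvg0 : \int[m]_x (U x * s n (W x))%:E @[n --> \oo] --> 0.
  by under eq_fun do rewrite integral_preimage_eq0_nnsfun//; exact: cvg_cst.
have cvgk : \int[m]_x (U x * s n (W x))%:E @[n --> \oo] -->
    \int[m]_x (U x * (k (W x) + C))%:E.
  apply: (@dominated_cvg _ _ _ m _ measurableT _ _
    (fun x => (C *+ 2)%:E * `|(U x)%:E|)) => //.
  - move=> n; apply/measurable_EFinP; apply: measurable_funM => //.
    exact: measurableT_comp.
  - move=> x _; under eq_fun do rewrite EFinM.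
    rewrite EFinM; apply: cvgeZl => //.
    exact: (@cvg_nnsfun_approx _ _ _ _ measurableT _ mkC kC0).
  - by apply: integrableZl => //; exact: integrable_abse.
  - by move=> n x _; rewrite lee_fin normrM mulrC ler_wpM2r.
have : \int[m]_x (U x * (k (W x) + C))%:E = 0.
  by rewrite -(cvg_lim _ cvgk)//; exact: cvg_lim cvg0.
under eq_integral do rewrite mulrDr EFinD (mulrC _ C) (EFinM C).
rewrite integralD//; last exact: integrableZl.
by rewrite integralZl// U0T mule0 adde0.
Qed.

(** The pull-out property of conditional expectation: the difference X - Y has
    zero integral on every event of W. *)
Lemma is_cond_exp_pull_out (P : probability T R) (X Y : T -> R)
    (W : {RV P >-> R}) (k : R -> R) (C : R) :
  is_cond_exp P X W Y -> measurable_fun setT k -> (forall y, (`|k y| <= C)%R) ->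
  \int[P]_x (X x * k (W x))%:E = \int[P]_x (Y x * k (W x))%:E.
Proof.
move=> [iX iY _ XY] mk kC.
have mW : measurable_fun setT W by exact: measurable_funPT.
have iXk (Z : T -> R) : P.-integrable setT (EFin \o Z) ->
    P.-integrable setT (fun x => (Z x * k (W x))%:E).
  move=> iZ.
  have mkW : measurable_fun setT (k \o W) by exact: measurableT_comp mk mW.
  exact: (integrable_mul_bounded iZ mkW (fun x => kC (W x))).
have iU : P.-integrable setT (EFin \o (fun x => X x - Y x)%R).
  exact: (integrableB measurableT iX iY).
have := integral_preimage_eq0 (m := P) (W := W) (k := k) mW iU _ mk kC.
under eq_integral do rewrite mulrBl EFinB.
rewrite integralB//; [|exact: iXk|exact: iXk].
move=> XY0; rewrite -[LHS](subeK _ (integrable_fin_num measurableT (iXk _ iY))).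
rewrite XY0 ?add0e// => B mB.
have mWB : measurable (W @^-1` B).
  by rewrite -[X in measurable X]setTI; exact: mW.
under eq_integral do rewrite EFinB.
have iXB : P.-integrable (W @^-1` B) (EFin \o X) by exact: integrableS iX.
have iYB : P.-integrable (W @^-1` B) (EFin \o Y) by exact: integrableS iY.
rewrite integralB// XY ?subee ?integrable_fin_num//.
by exists B => //; rewrite setTI.
Qed.

End conditional_expectation.

(** * A regular solution of the Stein equation *)

Section stein_solution.
Context (R : realType).
Local Notation N := (@normal_prob R 0 1).
Implicit Types h f : R -> R.
Local Open Scope ring_scope.

Lemma le_sup_norm f : bounded_fun f -> forall x, `|f x| <= sup_norm f.
Proof.
move=> [M [Mreal fM]] x; apply: ub_le_sup; last by exists x.
exists (M + 1) => _ [y _ <-]; apply: fM => //.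
by rewrite ltrDl.
Qed.

(** Here a0 = F' where F is, up to sign, the classical solution of the Stein
    equation F'' - x F' = h - Nh, and a1, a2 are the next two derivatives of a0.
    The function a2 is only Lipschitz, as the fourth derivative of h need not be
    continuous, so the last clause is a Taylor bound instead of a bound on the
    derivative of a2. *)
Lemma stein_solution h : bounded_derivatives 4 h ->
  exists a0 a1 a2 : R -> R, exists C : R,
    [/\ forall x, h x - \int[N]_z h z = x * a0 x - a1 x,
        forall x : R, is_derive x 1 a0 (a1 x),
        continuous a1 /\ continuous a2,
        forall x, [/\ `|a0 x| <= C, `|a1 x| <= C &
          `|a2 x| <= sup_norm (h^`(3)%classic) / 3] &
        forall a b, `|a1 b - a1 a - (b - a) * a2 a| <=
          sup_norm (h^`(4)%classic) / 8 * (b - a) ^+ 2].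
Proof.
move=> [dh bh]; pose M k := sup_norm (h^`(k)%classic).
have hM k : (1 <= k <= 4)%N -> forall x, `|h^`(k)%classic x| <= M k.
  by move=> k14; apply: le_sup_norm; exact: bh.
have M0 k : (1 <= k <= 4)%N -> 0 <= M k.
  by move=> k14; exact: le_trans (hM k k14 0).
pose C := M 1 + M 2 + M 3.
have hC k : (1 <= k <= 3)%N -> forall x, `|h^`(k)%classic x| <= C.
  have [m1 m2 m3] : [/\ M 1 <= C, M 2 <= C & M 3 <= C].
    rewrite /C; move: (M0 1 isT) (M0 2 isT) (M0 3 isT).
    by move: (M 1) (M 2) (M 3) => *; split; lra.
  case: k => [|[|[|[|k]]]] // _ x.
  - exact: le_trans (hM 1 isT x) m1.
  - exact: le_trans (hM 2 isT x) m2.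
  - exact: le_trans (hM 3 isT x) m3.
have lip k : (k < 4)%N -> (0 < k)%N ->
    forall x y, `|h^`(k)%classic x - h^`(k)%classic y| <= M k.+1 * `|x - y|.
  move=> k4 k0; apply: bounded_derive1_lipschitz; first by move=> x; exact: dh.
  by apply: (hM k.+1); rewrite /= k4.
have ct k : (k < 4)%N -> continuous (h^`(k)%classic).
  by move=> k4; apply: derivableT_continuous => x; exact: dh.
have mh k : (k < 4)%N -> measurable_fun setT (h^`(k)%classic).
  by move=> k4; apply: continuous_measurable_fun; exact: ct.
exists (arc_average 0 (h^`(1)%classic)), (arc_average 1 (h^`(2)%classic)).
exists (arc_average 2 (h^`(3)%classic)), C.
have T k : (0 < k < 3)%N -> forall a b,
    `|arc_average k.-1 (h^`(k)%classic) b - arc_average k.-1 (h^`(k)%classic) a -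
     (b - a) * arc_average k (h^`(k.+1)%classic) a| <=
    M k.+2 / 2 / k.+2%:R * (b - a) ^+ 2.
  case: k => [//|k] /= k3; have k4 : (k.+1 < 4)%N by exact: leq_trans k3 _.
  apply: (@arc_average_taylor _ k (h^`(k.+1)%classic) C (M k.+3)).
  - by move=> x; exact: dh.
  - by apply: hC; rewrite /= ltnW.
  - by apply: (hC k.+2).
  - by apply: (lip k.+2).
split.
- apply: (@stein_equation _ h C).
  + by move=> x; exact: (dh 0).
  + by move=> x; exact: (dh 1).
  + exact: (ct 2).
  + exact: (hC 1).
  + exact: (hC 2).
- by move=> x; apply: is_derive_quadratic => b; exact: (T 1).
- split; apply: lipschitz_continuous.
    by apply: (arc_average_lipschitz _ (mh 2 isT) (hC 2 isT)); exact: (lip 2).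
  by apply: (arc_average_lipschitz _ (mh 3 isT) (hC 3 isT)); exact: (lip 3).
- have C0 : 0 <= C by exact: le_trans (hC 1 isT 0).
  move=> x; split.
  + have := arc_average_bounded 0 (mh 1 isT) (hC 1 isT) x.
    by rewrite divr1.
  + have := arc_average_bounded 1 (mh 2 isT) (hC 2 isT) x.
    by move=> /le_trans; apply; rewrite ler_pdivrMr// ler_peMr// ler1n.
  + exact: (arc_average_bounded 2 (mh 3 isT) (hM 3 isT) x).
- rewrite -/(M 4%N) => a b; have := T 2%N isT a b => /= /le_trans; apply.
  by rewrite -[M 4%N / 2 / 4]mulrA -invfM -natrM.
Qed.

End stein_solution.

(** * The zero bias coupling *)

Section zero_bias.
Context d (T : measurableType d) (R : realType) (P : probability T R).
Local Open Scope ring_scope.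

(** Expand the nonnegative integral of the square of |Y| - E|Y|. *)
Lemma Rintegral_norm_le_sqrte (Y : T -> R) :
  P.-integrable setT (EFin \o Y) ->
  ((\int[P]_w `|Y w|)%:E <= sqrte 'E_P[fun w => (Y w ^+ 2)%R])%E.
Proof.
move=> iY; have mY : measurable_fun setT Y.
  exact/measurable_EFinP/(measurable_int P).
have Y20 : (0 <= 'E_P[fun w => (Y w ^+ 2)%R])%E.
  by apply: expectation_ge0 => w; exact: sqr_ge0.
have [->|Yoo] := eqVneq ('E_P[fun w => (Y w ^+ 2)%R])%E +oo%E.
  by rewrite leey.
have iY2 : P.-integrable setT (EFin \o (fun w => Y w ^+ 2)).
  apply/integrableP; split.
    by apply/measurable_EFinP; exact: measurable_funX.
  under eq_integral do rewrite /= ger0_norm ?sqr_ge0//.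
  by rewrite ltey; move: Yoo; rewrite unlock.
have iaY : P.-integrable setT (EFin \o (fun w => `|Y w|)) by exact: integrable_norm.
set a := \int[P]_w `|Y w|.
have [i1 e1] := Rintegral_lincomb 1 (2 * a) iY2 iaY.
have ic := finite_measure_integrable_cst P 1 measurableT.
have [_ e2] := Rintegral_lincomb 1 (- a ^+ 2) i1 ic.
have a2 : a ^+ 2 <= \int[P]_w (Y w ^+ 2).
  have : 0 <= \int[P]_w (1 * (1 * Y w ^+ 2 - 2 * a * `|Y w|) - - a ^+ 2 * 1).
    apply: Rintegral_ge0 => w _.
    rewrite [leRHS](_ : _ = (`|Y w| - a) ^+ 2) ?sqr_ge0//.
    by rewrite -(real_normK (num_real (Y w))); ring.
  rewrite e2 e1 Rintegral_cst//= probability_setT/= -/a => H.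
  by rewrite -subr_ge0 (le_trans H)// le_eqVlt; apply/orP; left; apply/eqP; ring.
have -> : ('E_P[fun w => (Y w ^+ 2)%R] = (\int[P]_w (Y w ^+ 2))%:E)%E.
  by rewrite unlock fineK// integrable_fin_num.
rewrite lee_fin -[leLHS]ger0_norm ?Rintegral_ge0//.
by rewrite -sqrtr_sqr ler_wsqrtr.
Qed.

Lemma variance_integrable_sqr (W : {RV P >-> R}) (v : R) :
  ('E_P[W] = 0)%E -> ('V_P[W] = v%:E)%E ->
  P.-integrable setT (fun w => (W w ^+ 2)%:E).
Proof.
move=> EW VW; apply/integrableP; split.
  by apply/measurable_EFinP; apply: measurable_funX.
under eq_integral do rewrite /= ger0_norm ?sqr_ge0//.
move: VW; rewrite /variance unlock EW/= unlock => VW.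
rewrite (_ : (\int[P]_w _)%E = v%:E) ?ltry// -VW.
by apply: eq_integral => w _; rewrite !fctE /= subr0 expr2.
Qed.

(** Zero biasing applied to a0(. / sigma) rewrites the Stein expression as the
    mean of a1(Ws / sigma) - a1(W / sigma). The mean of its linear part,
    a2(W / sigma) times (Ws - W) / sigma, is unchanged when Ws - W is replaced by
    its conditional expectation Y; the remainder is quadratic in Ws - W. *)
Lemma zero_bias_bound (W Ws : {RV P >-> R}) (sigma : R) (Y : T -> R)
    (h a0 a1 a2 : R -> R) (m C K2 K3 : R) :
  0 < sigma -> ('E_P[W] = 0)%E -> ('V_P[W] = (sigma ^+ 2)%:E)%E ->
  zero_biased P W Ws ->
  is_cond_exp P (fun w => Ws w - W w) W Y ->
  P.-integrable setT (fun w => ((Ws w - W w) ^+ 2)%:E) ->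
  (forall x, h x - m = x * a0 x - a1 x) ->
  (forall x : R, is_derive x 1 a0 (a1 x)) -> continuous a1 -> continuous a2 ->
  (forall x, [/\ `|a0 x| <= C, `|a1 x| <= C & `|a2 x| <= K2]) ->
  (forall a b, `|a1 b - a1 a - (b - a) * a2 a| <= K3 * (b - a) ^+ 2) ->
  P.-integrable setT (fun w => (h (W w / sigma))%:E) /\
  `|\int[P]_w h (W w / sigma) - m| <=
    K2 / sigma * \int[P]_w `|Y w| +
    K3 / sigma ^+ 2 * \int[P]_w ((Ws w - W w) ^+ 2).
Proof.
move=> s0 EW VW zb cY iD2 eqn d0 c1 c2 bnd tay.
have sN0 : sigma != 0 by rewrite gt_eqF.
have [iD iY _ _] := cY.
have mW : measurable_fun setT W by exact: measurable_funPT.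
have mWs : measurable_fun setT Ws by exact: measurable_funPT.
have iW := integrable_of_sqr mW (variance_integrable_sqr EW VW).
have c0 : continuous a0.
  by apply: derivableT_continuous => x; case: (d0 x).
have a0C y : `|a0 y| <= C by case: (bnd y).
have a1C y : `|a1 y| <= C by case: (bnd y).
have a2M y : `|a2 y| <= K2 by case: (bnd y).
have c0s := continuous_scale (c := sigma) c0.
have c1s := continuous_scale (c := sigma) c1.
have c2s := continuous_scale (c := sigma) c2.
have mu_ (u : R -> R) (V : T -> R) : continuous (fun y : R => u (y / sigma)) ->
    measurable_fun setT V -> measurable_fun setT (fun w => u (V w / sigma)).
  move=> cu mV; have mcu := continuous_measurable_fun cu.
  exact: (measurableT_comp mcu mV).
have i0 : P.-integrable setT (fun w => (W w * a0 (W w / sigma))%:E).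
  exact: (integrable_mul_bounded iW (mu_ _ _ c0s mW) (fun w => a0C _)).
have i1 (V : T -> R) : measurable_fun setT V ->
    P.-integrable setT (fun w => (a1 (V w / sigma))%:E).
  move=> mV.
  have b w : `|a1 (V w / sigma)| <= C by exact: a1C.
  exact: probability_bounded_integrable (mu_ _ _ c1s mV) b.
have df (y : R) : is_derive y 1 (fun y => a0 (y / sigma))
    (sigma^-1 * a1 (y / sigma)).
  have dm : is_derive y 1 (fun y : R => y / sigma) sigma^-1.
    have -> : (fun y : R => y / sigma) = sigma^-1 \*: id.
      by apply/funext => z; rewrite /GRing.scale/= mulrC.
    apply: (is_derive_eq (is_deriveZ sigma^-1 (is_derive_id y 1))).
    by rewrite /GRing.scale/= mulr1.
  have := @is_derive1_comp R a0 (fun y : R => y / sigma) y _ _ (d0 _) dm.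
  by rewrite mulrC.
have dfE : (fun y => a0 (y / sigma))^`()%classic =
    (fun y => sigma^-1 * a1 (y / sigma)).
  by apply/funext => y; rewrite derive1E (@derive_val _ _ _ _ _ _ _ (df y)).
have zbE : \int[P]_w (W w * a0 (W w / sigma)) =
    sigma * \int[P]_w a1 (Ws w / sigma).
  have := zb (fun y => a0 (y / sigma)).
  rewrite dfE VW => /(_ _ i0 _) H.
  have i1s := integrableZl measurableT sigma^-1 (i1 _ mWs).
  have drv (y : R) : derivable (fun y : R => a0 (y / sigma)) y 1 by case: (df y).
  have {}H := H drv i1s.
  rewrite unlock in H; rewrite /Rintegral H fineM//; last exact: integrable_fin_num.
  have := RintegralZl sigma^-1 measurableT (i1 _ mWs); rewrite /Rintegral => ->.
  by rewrite /= mulrA expr2 mulfK.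
(* written in the shape of the left-hand side of Rintegral_lincomb *)
have ehE : (fun w => h (W w / sigma)) = (fun w =>
    1 * (1 * m - - sigma^-1 * (W w * a0 (W w / sigma))) -
    1 * a1 (W w / sigma)).
  by apply/funext => w; have := eqn (W w / sigma); lra.
have ic := finite_measure_integrable_cst P m measurableT.
have [L1 L1E] := Rintegral_lincomb 1 (- sigma^-1) ic i0.
have [L2 L2E] := Rintegral_lincomb 1 1 L1 (i1 _ mW).
pose D w := Ws w - W w.
(* the second-order Taylor remainder of a1 between W / sigma and Ws / sigma *)
pose rem w := a1 (Ws w / sigma) - a1 (W w / sigma) -
  sigma^-1 * (D w * a2 (W w / sigma)).
have remE : rem = fun w => 1 * (1 * a1 (Ws w / sigma) - 1 * a1 (W w / sigma)) -
    sigma^-1 * (D w * a2 (W w / sigma)).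
  by apply/funext => w; rewrite /rem !mul1r.
have ma2 := mu_ _ _ c2s mW.
have a2MW w : `|a2 (W w / sigma)| <= K2 by exact: a2M.
have iDk := integrable_mul_bounded iD ma2 a2MW.
have [L3 L3E] := Rintegral_lincomb 1 1 (i1 _ mWs) (i1 _ mW).
have [L4 L4E] := Rintegral_lincomb 1 sigma^-1 L3 iDk.
split.
  have -> : (fun w => (h (W w / sigma))%:E) = EFin \o (fun w => h (W w / sigma)).
    by [].
  by rewrite ehE.
have main : \int[P]_w h (W w / sigma) - m = \int[P]_w rem w +
    sigma^-1 * \int[P]_w (Y w * a2 (W w / sigma)).
  have -> : \int[P]_w (Y w * a2 (W w / sigma)) =
      \int[P]_w (D w * a2 (W w / sigma)).
    congr fine; apply/esym.
    have mc2s := continuous_measurable_fun c2s.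
    exact: (is_cond_exp_pull_out cY mc2s (fun y => a2M (y / sigma))).
  have -> : \int[P]_w h (W w / sigma) = m + sigma^-1 *
      \int[P]_w (W w * a0 (W w / sigma)) - \int[P]_w a1 (W w / sigma).
    rewrite ehE; apply: (etrans L2E); rewrite L1E !mul1r mulNr opprK.
    by rewrite Rintegral_cst//= probability_setT mulr1.
  rewrite zbE mulKf// remE L4E L3E; ring.
have irem : P.-integrable setT (EFin \o rem) by rewrite remE.
have remK w : `|rem w| <= K3 / sigma ^+ 2 * D w ^+ 2.
  have := tay (W w / sigma) (Ws w / sigma).
  rewrite -mulrBl -/(D w) exprMn exprVn (mulrC (D w)) -(mulrA _ (D w)).
  by move=> remw; rewrite mulrAC -mulrA.
rewrite main addrC (le_trans (ler_normD _ _))// lerD//.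
- rewrite normrM gtr0_norm ?invr_gt0// (mulrC K2) -mulrA ler_wpM2l//.
    by rewrite invr_ge0 ltW.
  have iYk := integrable_mul_bounded iY ma2 a2MW.
  rewrite (le_trans (le_normr_Rintegral measurableT iYk))//.
  rewrite -RintegralZl//; last exact: integrable_norm.
  apply: le_Rintegral => //; first exact: integrable_norm.
    exact: (integrableZl measurableT K2 (integrable_norm iY)).
  by move=> w _; rewrite normrM mulrC ler_wpM2r.
- rewrite (le_trans (le_normr_Rintegral measurableT irem))// -RintegralZl//.
  apply: le_Rintegral => //; first exact: integrable_norm.
  exact: (integrableZl measurableT (K3 / sigma ^+ 2) iD2).
Qed.

End zero_bias.

Local Open Scope ereal_scope.

Theorem theorem3p1 (d : measure_display) (T : measurableType d) (R : realType)
    (P : probability T R) (W Ws : {RV P >-> R}) (sigma : R)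
    (sigma_gt0 : (0 < sigma)%R)
    (meanW : 'E_P[W] = 0)
    (varW : 'V_P[W] = (sigma ^+ 2)%:E)
    (zbW : zero_biased P W Ws)
    (Y : T -> R) (condY : is_cond_exp P (fun w => Ws w - W w)%R W Y)
    (h : R -> R) (bdh : bounded_derivatives 4 h) :
  `| 'E_P[fun w => h (W w / sigma)%R] - 'E_(normal_prob 0 1)[h] | <=
  if 'E_P[fun w => ((Ws w - W w) ^+ 2)%R] == +oo then +oo else
    ((3 * sigma)^-1 * sup_norm (h^`(3)%classic))%:E
      * sqrte 'E_P[fun w => (Y w ^+ 2)%R]
    + ((8 * sigma ^+ 2)^-1 * sup_norm (h^`(4)%classic))%:E
      * 'E_P[fun w => ((Ws w - W w) ^+ 2)%R].
Proof.
have [_|D2oo] := eqVneq 'E_P[fun w => ((Ws w - W w) ^+ 2)%R] +oo.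
  exact: leey.
have iD2 : P.-integrable setT (fun w => ((Ws w - W w) ^+ 2)%:E).
  apply/integrableP; split.
    apply/measurable_EFinP/measurable_funX/measurable_funB.
      exact: measurable_funPT.
    exact: measurable_funPT.
  under eq_integral do rewrite /= ger0_norm ?sqr_ge0//.
  by rewrite ltey; move: D2oo; rewrite unlock.
have [a0 [a1 [a2 [C [eqn d0 [c1 c2] bnd tay]]]]] := stein_solution bdh.
have [ih bound] :=
  zero_bias_bound sigma_gt0 meanW varW zbW condY iD2 eqn d0 c1 c2 bnd tay.
have [_ iY _ _] := condY.
have iN : (normal_prob 0 1).-integrable setT (EFin \o h).
  have [dh bh] := bdh; apply: integrable_normal_lipschitz.
  apply: bounded_derive1_lipschitz; first by move=> x; exact: (dh 0%N).
  exact/le_sup_norm/(bh 1%N).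
have -> : 'E_P[fun w => h (W w / sigma)%R] = (\int[P]_w h (W w / sigma)%R)%R%:E.
  by rewrite unlock fineK// integrable_fin_num.
have -> : 'E_(normal_prob 0 1)[h] = (\int[normal_prob 0 1]_z h z)%R%:E.
  by rewrite unlock fineK// integrable_fin_num.
have -> : 'E_P[fun w => ((Ws w - W w) ^+ 2)%R] =
    (\int[P]_w ((Ws w - W w) ^+ 2))%R%:E.
  by rewrite unlock fineK// integrable_fin_num.
have div2E (x y z : R) : (x / y / z = (y * z)^-1 * x)%R.
  by rewrite invfM; ring.
have sup0 k : (1 <= k <= 4)%N -> (0 <= sup_norm (h^`(k)%classic))%R.
  by case: bdh => _ bh k14; exact: le_trans (le_sup_norm (bh k k14) 0%R).
move: bound; rewrite !div2E -lee_fin => /le_trans; apply.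
rewrite EFinD leeD// EFinM lee_wpmul2l//; last exact: Rintegral_norm_le_sqrte.
by rewrite lee_fin mulr_ge0 ?sup0// invr_ge0 mulr_ge0// ltW.
Qed.
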